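(* Let $1\le\alpha<\beta\le N$, $\lambda_\alpha\ge1$, and $J\in\mathcal I_{\lambda_{\alpha,\beta}}$. Then $$(\tilde d_{\{\alpha,\beta\}}U_J)(t;z)=-h\sum_{b=1}^{\lambda_\beta+1}W_{(J)^{b}_{\beta,\alpha}}(t;z).$$
   Context: Fix positive integers $N,n$ and $h\in\mathbb C^\times$. For $\lambda=(\lambda_1,\dots,\lambda_N)\in\mathbb Z_{\ge0}^N$ with $\lambda_1+\dots+\lambda_N=n$ put $\lambda^{(i)}=\lambda_1+\dots+\lambda_i$, $\lambda^{(0)}=0$; $\mathcal I_\lambda$ is the set of ordered partitions $I=(I_1,\dots,I_N)$ of $\{1,\dots,n\}$ into disjoint subsets with $|I_j|=\lambda_j$. Variables: $t=(t^{(j)}_a)$, $1\le j\le N-1$, $1\le a\le\lambda^{(j)}$; $t^{(N)}_a=z_a$, $1\le a\le n$. $\mathrm{Sym}_{x_1,\dots,x_k}f=\sum_{\sigma\in S_k}f(x_{\sigma(1)},\dots,x_{\sigma(k)})$; $\mathrm{Sym}_t=\mathrm{Sym}_{t^{(1)}_1,\dots,t^{(1)}_{\lambda^{(1)}}}\cdots\mathrm{Sym}_{t^{(N-1)}_1,\dots,t^{(N-1)}_{\lambda^{(N-1)}}}$. Empty products equal 1. For $I\in\mathcal I_\lambda$ write $I_1\cup\dots\cup I_j=\{i^{(j)}_1<\dots<i^{(j)}_{\lambda^{(j)}}\}$ and $$U_I(t;z)=\prod_{j=1}^{N-1}\prod_{a=1}^{\lambda^{(j)}}\Bigl(\prod_{c:\,i^{(j+1)}_c<i^{(j)}_a}(t^{(j)}_a-t^{(j+1)}_c)\prod_{d:\,i^{(j+1)}_d>i^{(j)}_a}(t^{(j)}_a-t^{(j+1)}_d-h)\prod_{b=a+1}^{\lambda^{(j)}}\frac{t^{(j)}_b-t^{(j)}_a-h}{t^{(j)}_b-t^{(j)}_a}\Bigr)$$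 ($c,d\in\{1,\dots,\lambda^{(j+1)}\}$), and $W_I=\mathrm{Sym}_t\,U_I$. For $\alpha\ne\beta$, $\lambda_{\alpha,\beta}=(\lambda_1,\dots,\lambda_\alpha-1,\dots,\lambda_\beta+1,\dots,\lambda_N)$. For a partition $J=(J_1,\dots,J_N)$ and $1\le b\le|J_\beta|$, $(J)^b_{\beta,\alpha}$ is obtained from $J$ by moving the $b$-th smallest element of $J_\beta$ into $J_\alpha$. If $J\in\mathcal I_{\lambda_{\alpha,\beta}}$ then $(J)^b_{\beta,\alpha}\in\mathcal I_\lambda$ for $b=1,\dots,\lambda_\beta+1$. For $\alpha<\beta$ let $t_{\{\alpha,\beta\}}$ be the collection $t$ with the variables $t^{(i)}_{\lambda^{(i)}}$, $\alpha\le i<\beta$, removed. For $J\in\mathcal I_{\lambda_{\alpha,\beta}}$, $U_J$ (given by the formula above with $\lambda$ replaced by $\lambda_{\alpha,\beta}$) is a function of $t_{\{\alpha,\beta\}},z$. For a rational function $g$ of $t_{\{\alpha,\beta\}},z$ put $\tilde d_{\{\alpha,\beta\}}g=\mathrm{Sym}_t\bigl(g\cdot(A_{\alpha,\beta}-B_{\alpha,\beta})\bigr)$, where $$A_{\alpha,\beta}=(t^{(\alpha-1)}_{\lambda^{(\alpha-1)}}-t^{(\alpha)}_{\lambda^{(\alpha)}})\prod_{i=\alpha}^{\beta-1}\prod_{a=1}^{\lambda^{(i-1)}-1}(t^{(i-1)}_a-t^{(i)}_{\lambda^{(i)}})\cdot(t^{(\beta-1)}_{\lambda^{(\beta-1)}}-t^{(\beta)}_{\lambda^{(\beta)}}-h)\prod_{i=\alpha}^{\beta-1}\prod_{a=1}^{\lambda^{(i+1)}-1}(t^{(i)}_{\lambda^{(i)}}-t^{(i+1)}_a-h)\prod_{i=\alpha}^{\beta-1}\prod_{a=1}^{\lambda^{(i)}-1}\frac{t^{(i)}_a-t^{(i)}_{\lambda^{(i)}}-h}{t^{(i)}_a-t^{(i)}_{\lambda^{(i)}}},$$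 $$B_{\alpha,\beta}=(t^{(\alpha-1)}_{\lambda^{(\alpha-1)}}-t^{(\alpha)}_{\lambda^{(\alpha)}}-h)\prod_{i=\alpha}^{\beta-1}\prod_{a=1}^{\lambda^{(i-1)}-1}(t^{(i-1)}_a-t^{(i)}_{\lambda^{(i)}}-h)\cdot(t^{(\beta-1)}_{\lambda^{(\beta-1)}}-t^{(\beta)}_{\lambda^{(\beta)}})\prod_{i=\alpha}^{\beta-1}\prod_{a=1}^{\lambda^{(i+1)}-1}(t^{(i)}_{\lambda^{(i)}}-t^{(i+1)}_a)\prod_{i=\alpha}^{\beta-1}\prod_{a=1}^{\lambda^{(i)}-1}\frac{t^{(i)}_{\lambda^{(i)}}-t^{(i)}_a-h}{t^{(i)}_{\lambda^{(i)}}-t^{(i)}_a},$$ with the convention that the factors containing $t^{(\alpha-1)}_{\lambda^{(\alpha-1)}}$ are replaced by 1 if $\lambda^{(\alpha-1)}=0$ (in particular if $\alpha=1$). *)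

(* Defs.v *)
From HB Require Import structures.
From mathcomp Require Import all_boot all_order all_algebra.
From mathcomp Require Import perm generic_quotient complex reals.
From mathcomp Require Import mpoly.

Set Implicit Arguments.
Unset Strict Implicit.
Unset Printing Implicit Defensive.

Import GRing.Theory.
Local Open Scope ring_scope.

(* Conventions.  The parts of a composition lam and of an ordered partition I
   are indexed from 0 by 'I_N, and the set {1, ..., n} is modelled by 'I_n; only
   the order of its elements is used.  The superscript j and the subscript a of
   a variable t^(j)_a are natural numbers counted from 1. *)

Section FractionMap.
Variables (R S : idomainType) (f : R -> S).

(* The extension x / y |-> f x / f y of f to the fields of fractions; it is
   meaningful for an injective ring morphism f (see fracmap_div). *)
Definition fracmap (x : {fraction R}) : {fraction S} :=
  tofrac (f \n_(repr x)) / tofrac (f \d_(repr x)).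

End FractionMap.

Section FractionMapTheory.
Variables (R S : idomainType) (f : {rmorphism R -> S}).
Hypothesis f_inj : injective f.

Lemma fraction_div (x : {fraction R}) :
  x = tofrac \n_(repr x) / tofrac \d_(repr x).
Proof.
have d0 := denom_ratioP (repr x).
apply: (canRL (mulfK _)); first by rewrite tofrac_eq0.
rewrite -{1}[x]reprK !piE /FracField.mulf.
apply/eqmodP; rewrite /= FracField.equivfE !numden_Ratio ?mulr1 ?oner_eq0 //.
by rewrite mulrC.
Qed.

Lemma fracmap_div (x y : R) :
  y != 0 -> fracmap f (tofrac x / tofrac y) = tofrac (f x) / tofrac (f y).
Proof.
move=> y0; rewrite /fracmap; set z := tofrac x / tofrac y.
have d0 := denom_ratioP (repr z).
have ne0 u : u != 0 -> tofrac (f u) != 0.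
  by rewrite tofrac_eq0 -(rmorph0 f) (inj_eq f_inj).
apply/eqP; rewrite eqr_div ?ne0 // -!tofracM tofrac_eq -!rmorphM.
apply/eqP; congr (f _); apply/eqP; rewrite -tofrac_eq !tofracM.
by rewrite -eqr_div ?tofrac_eq0 // -fraction_div.
Qed.

Lemma fracmap_tofrac (x : R) : fracmap f (tofrac x) = tofrac (f x).
Proof.
by have := fracmap_div x (oner_neq0 R); rewrite (rmorph1 f) !tofrac1 !divr1.
Qed.

Fact fracmap_zmod : zmod_morphism (fracmap f).
Proof.
move=> x y; rewrite (fraction_div x) (fraction_div y).
set nx := \n_(repr x); set dx := \d_(repr x).
set ny := \n_(repr y); set dy := \d_(repr y).
have dx0 : dx != 0 := denom_ratioP (repr x).
have dy0 : dy != 0 := denom_ratioP (repr y).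
have fne0 u : u != 0 -> tofrac (f u) != 0.
  by rewrite tofrac_eq0 -(rmorph0 f) (inj_eq f_inj).
rewrite -[- (_ / _)]mulNr addf_div ?tofrac_eq0 // -tofracN -!tofracM -tofracD.
rewrite !fracmap_div ?mulf_neq0 // -[- (_ / _)]mulNr addf_div ?fne0 //.
by rewrite (rmorphD f) !(rmorphM f) (rmorphN f) tofracD !tofracM tofracN.
Qed.

Fact fracmap_monoid : monoid_morphism (fracmap f).
Proof.
split=> [|x y]; first by rewrite -tofrac1 fracmap_tofrac (rmorph1 f).
rewrite (fraction_div x) (fraction_div y).
rewrite mulf_div -!tofracM !fracmap_div ?mulf_neq0 ?denom_ratioP //.
by rewrite !(rmorphM f) !tofracM mulf_div.
Qed.

End FractionMapTheory.

Section OrderedPartitions.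
Variables (N n : nat).
Implicit Types (lam : {ffun 'I_N -> nat}) (I J : {ffun 'I_N -> {set 'I_n}}).

(* lambda^(j), the sum of the first j parts *)
Definition psum lam (j : nat) : nat := (\sum_(i < N | (i < j)%N) lam i)%N.

(* lambda_{al,be} *)
Definition shift lam (al be : 'I_N) : {ffun 'I_N -> nat} :=
  [ffun i => if i == al then (lam i).-1
             else if i == be then (lam i).+1 else lam i].

(* the set of ordered partitions I_lambda *)
Definition opart lam : {set {ffun 'I_N -> {set 'I_n}}} :=
  [set I : {ffun 'I_N -> {set 'I_n}} | [&& [forall j, #|I j| == lam j],
               [forall i, forall j, (i != j) ==> [disjoint I i & I j]]
             & \bigcup_j I j == setT]].

(* The a-th smallest element of A, a >= 1: enum lists 'I_n in increasing order.
   Only used for 1 <= a <= #|A|. *)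
Definition kth (A : {set 'I_n}) (a : nat) : nat :=
  nth 0%N [seq val x | x <- enum A] a.-1.

(* I_1 \cup ... \cup I_j *)
Definition punion I (j : nat) : {set 'I_n} := \bigcup_(i < N | (i < j)%N) I i.

(* i^(j)_a *)
Definition ielt I (j a : nat) : nat := kth (punion I j) a.

(* (J)^b_{be,al}: the b-th smallest element of J_be is moved to J_al *)
Definition move J (be al : 'I_N) (b : nat) : {ffun 'I_N -> {set 'I_n}} :=
  let x := [set y in J be | val y == kth (J be) b] in
  [ffun i => if i == be then J i :\: x
             else if i == al then J i :|: x else J i].

End OrderedPartitions.

Section RationalFunctions.
Variables (C : fieldType) (N n : nat).

(* One polynomial variable for each pair (j, a) with 0 <= j <= N, 0 <= a <= n.
   All the collections t, t_{al,be}, z are subcollections of these, so that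
   functions attached to lambda and to lambda_{al,be} live in the same field;
   the pairs with j = 0, or a = 0, or a > lambda^(j) are not used. *)
Definition nvar : nat := (N.+1 * n.+1)%N.
Definition vidx (j : 'I_N.+1) (a : 'I_n.+1) : 'I_nvar := mxvec_index j a.

Definition polyring := {mpoly C[nvar]}.
Definition ratfun := {fraction {mpoly C[nvar]}}.

Definition cst (c : C) : ratfun := tofrac (c%:MP : {mpoly C[nvar]}).

(* t^(j)_a, with t^(N)_a = z_a *)
Definition tvar (j a : nat) : ratfun :=
  tofrac ('X_(vidx (inord j) (inord a)) : {mpoly C[nvar]}).

(* Substitution of t^(j)_(s a) for t^(j)_a, all a, in a polynomial. *)
Definition psubst (j : nat) (s : 'S_n.+1) (p : polyring) : polyring :=
  p \mPo [tuple mxvec (\matrix_(i, a)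
                        ('X_(vidx i (if (i : nat) == j then s a else a))
                           : {mpoly C[nvar]})) 0 v | v < nvar].

(* The same substitution in a rational function. *)
Definition vsubst (j : nat) (s : 'S_n.+1) : ratfun -> ratfun :=
  fracmap (psubst j s).

Fact psubst_zmod j s : zmod_morphism (psubst j s).
Proof. by move=> p q; rewrite /psubst rmorphB. Qed.
HB.instance Definition _ j s :=
  GRing.isZmodMorphism.Build polyring polyring (psubst j s) (psubst_zmod j s).

Fact psubst_monoid j s : monoid_morphism (psubst j s).
Proof. by split=> [|p q]; rewrite /psubst ?rmorph1 ?rmorphM. Qed.
HB.instance Definition _ j s :=
  GRing.isMonoidMorphism.Build polyring polyring (psubst j s)
    (psubst_monoid j s).

Lemma psubstX j s i a :
  psubst j s 'X_(vidx i a) = 'X_(vidx i (if (i : nat) == j then s a else a)).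
Proof.
by rewrite /psubst comp_mpolyXU -tnth_nth tnth_mktuple mxvecE mxE.
Qed.

Lemma psubstK j s : cancel (psubst j s) (psubst j s^-1%g).
Proof.
elim/mpolyind=> [|c m p _ _ IHp]; first by rewrite !(rmorph0 (psubst _ _)).
rewrite !(rmorphD (psubst _ _)); congr (_ + _); last exact: IHp.
rewrite /= /psubst !comp_mpolyZ; congr (_ *: _).
rewrite comp_mpolyX rmorph_prod mpolyXE_id; apply: eq_bigr => v _ /=.
rewrite rmorphXn /=; congr (_ ^+ _); rewrite tnth_mktuple.
case/mxvec_indexP: v => i a; rewrite mxvecE mxE -/(psubst _ _ _) psubstX.
by case: eqP => // _; rewrite permK.
Qed.

Lemma psubst_inj j s : injective (psubst j s).
Proof. exact: can_inj (psubstK j s). Qed.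

Fact vsubst_zmod j s : zmod_morphism (vsubst j s).
Proof. exact: fracmap_zmod (@psubst_inj j s). Qed.
HB.instance Definition _ j s :=
  GRing.isZmodMorphism.Build ratfun ratfun (vsubst j s) (vsubst_zmod j s).

Fact vsubst_monoid j s : monoid_morphism (vsubst j s).
Proof. exact: fracmap_monoid (@psubst_inj j s). Qed.
HB.instance Definition _ j s :=
  GRing.isMonoidMorphism.Build ratfun ratfun (vsubst j s) (vsubst_monoid j s).

Lemma vsubst_cst j s c : vsubst j s (cst c) = cst c.
Proof.
by rewrite /vsubst (fracmap_tofrac (@psubst_inj j s)) /= /psubst comp_mpolyC.
Qed.

Lemma vsubst_tvar j s i (a : 'I_n.+1) : (i <= N)%N ->
  vsubst j s (tvar i a) = tvar i (if i == j then s a else a).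
Proof.
move=> iN; rewrite /vsubst (fracmap_tofrac (@psubst_inj j s)) /= psubstX.
by rewrite /tvar inordK // inord_val; case: ifP => _; rewrite inord_val.
Qed.

(* Sym over t^(j)_1, ..., t^(j)_k: permutations of {1, ..., k} are the
   permutations of {0, ..., n} that move no other element. *)
Definition Sym1 (j k : nat) (g : ratfun) : ratfun :=
  \sum_(s : 'S_n.+1 | perm_on [set a : 'I_n.+1 | (0 < a <= k)%N] s)
     vsubst j s g.

Implicit Types (lam : {ffun 'I_N -> nat}) (I J : {ffun 'I_N -> {set 'I_n}}).

(* Sym_t = Sym1 1 (Sym1 2 (... (Sym1 (N-1) g))) *)
Definition Sym lam (g : ratfun) : ratfun :=
  foldr (fun j => Sym1 j (psum lam j)) g (iota 1 N.-1).

Variable h : C.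

Definition U lam I : ratfun :=
  \prod_(1 <= j < N) \prod_(1 <= a < (psum lam j).+1)
    ((\prod_(1 <= c < (psum lam j.+1).+1 | (ielt I j.+1 c < ielt I j a)%N)
        (tvar j a - tvar j.+1 c))
   * (\prod_(1 <= d < (psum lam j.+1).+1 | (ielt I j a < ielt I j.+1 d)%N)
        (tvar j a - tvar j.+1 d - cst h))
   * (\prod_(a.+1 <= b < (psum lam j).+1)
        ((tvar j b - tvar j a - cst h) / (tvar j b - tvar j a)))).

Definition W lam I : ratfun := Sym lam (U lam I).

(* A_{al,be} and B_{al,be}, for 1 <= al < be <= N counted from 1.  When
   lambda^(al-1) = 0 all the factors containing t^(al-1) disappear: one by the
   test, the others because their range is empty. *)
Definition Aab lam (al be : nat) : ratfun :=
  let L := psum lam in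
    (if L al.-1 == 0%N then 1 else tvar al.-1 (L al.-1) - tvar al (L al))
  * (\prod_(al <= i < be) \prod_(1 <= a < L i.-1)
       (tvar i.-1 a - tvar i (L i)))
  * (tvar be.-1 (L be.-1) - tvar be (L be) - cst h)
  * (\prod_(al <= i < be) \prod_(1 <= a < L i.+1)
       (tvar i (L i) - tvar i.+1 a - cst h))
  * (\prod_(al <= i < be) \prod_(1 <= a < L i)
       ((tvar i a - tvar i (L i) - cst h) / (tvar i a - tvar i (L i)))).

Definition Bab lam (al be : nat) : ratfun :=
  let L := psum lam in
    (if L al.-1 == 0%N then 1
     else tvar al.-1 (L al.-1) - tvar al (L al) - cst h)
  * (\prod_(al <= i < be) \prod_(1 <= a < L i.-1)
       (tvar i.-1 a - tvar i (L i) - cst h))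
  * (tvar be.-1 (L be.-1) - tvar be (L be))
  * (\prod_(al <= i < be) \prod_(1 <= a < L i.+1)
       (tvar i (L i) - tvar i.+1 a))
  * (\prod_(al <= i < be) \prod_(1 <= a < L i)
       ((tvar i (L i) - tvar i a - cst h) / (tvar i (L i) - tvar i a))).

(* The operator d~_{al,be}, on the whole field rather than on the subfield of
   functions of t_{al,be}, z only.  The indices al, be : 'I_N count from 0, hence the
   successors. *)
Definition dtilde lam (al be : 'I_N) (g : ratfun) : ratfun :=
  Sym lam (g * (Aab lam al.+1 be.+1 - Bab lam al.+1 be.+1)).

End RationalFunctions.

(* Main.v *)
From HB Require Import structures.
From mathcomp Require Import perm mpoly.
Require Import Defs.
From mathcomp Require Import all_boot all_order all_algebra.
From mathcomp Require Import complex reals.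
From mathcomp Require Import ring zify.

(** Count the parts from 1, write P_j = J_1 \cup ... \cup J_j and rename the
    variables of U_J by positions: y j q is the variable t^(j)_a for which q is
    the a-th smallest element of P_j.  Then U_J becomes the product [posU],
    which refers to positions only, and adding a position p to P_j with a new
    variable w multiplies it by the explicit factor [insfactor]
    ([posU_insert]).

    Let u_i = t^(i)_(lambda^(i)), al <= i < be, be the variables absent from
    U_J.  Let X_k be the product of the factors [cut] which insert every u_i
    at the cut between the positions less than k and the others.  With all the
    positions on the right of the cut X_k is A, with all of them on the left it
    is B ([Aab_cut], [Bab_cut]), so A - B is the telescoping sum of the
    differences X_p - X_(p+1) over the positions p, and the theorem follows by
    evaluating Sym (U_J * (X_p - X_(p+1))) for each p ([Sym_cut_step]).

    Both X_p and X_(p+1) contain the product G of the factors inserting the u_i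
    at p; they differ only in factors relating the u_i to the variables
    v_i = y i p at p itself ([cut_before], [cut_after]).  Let p lie in J_m.
    - If m > be, no v_i meets the u_i and the difference is 0.
    - If m = be, only v_be does, and
      X_p - X_(p+1) = G * ((u - v - h) - (u - v)) with u = u_(be-1), v = v_be;
      moreover U_J * G is, up to a renumbering of the variables of each level,
      U_I for the partition I obtained by moving p to J_al ([W_moved]).  This
      gives the term -h W_I.
    - If m < be, then U_J * G is invariant under each exchange of u_j with v_j,
      max(al, m) <= j < be ([posU_insert_swap]), and the remaining factor dies
      when it is averaged over these exchanges ([chain_vanish]).  The averaging
      goes one level at a time: what the A-side has accumulated, a(u, v), and
      what the B-side has, b(u, v), remain related by the divided difference
      b(u, v) = a(u, v) + h (a(v, u) - a(u, v)) / (v - u),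
      and at the last level this relation makes the two sides cancel. *)

Set Implicit Arguments.
Unset Strict Implicit.
Unset Printing Implicit Defensive.

Import GRing.Theory.
Local Open Scope ring_scope.

(** * Averaging over the exchanges of two chains of variables *)

Section SwapSums.
Variables (F : fieldType) (h : F).

(** One step of the averaging: the relation between b and a (where a', b' are
    the values after exchanging u and v) is inherited by the sums B and A over
    the exchange, now as functions of the pair (u1, v1) of the next level. *)
Lemma swap_step (u v u1 v1 a a' b b' : F) :
  v - u != 0 -> v1 - u1 != 0 ->
  b = a + h * (a' - a) / (v - u) -> b' = a' + h * (a - a') / (u - v) ->
  let A x y := a * ((v - u - h) / (v - u) * (u - y - h)) * (v - x)
             + a' * ((u - v - h) / (u - v) * (v - y - h)) * (u - x) in
  let B x y := b * ((u - v - h) / (u - v) * (u - y)) * (v - x - h)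
             + b' * ((v - u - h) / (v - u) * (v - y)) * (u - x - h) in
  B u1 v1 = A u1 v1 + h * (A v1 u1 - A u1 v1) / (v1 - u1).
Proof.
move=> n1 n2 -> -> /=; field.
by rewrite n2 n1 -oppr_eq0 opprB n1.
Qed.

(** The relation between b and a is exactly what is needed for this
    cancellation to hold for every z: both sides are affine in z, and the two
    coefficients give two linear conditions on a, a', b, b'. *)
Lemma swap_end (u v z a a' b b' : F) :
  v - u != 0 ->
  b = a + h * (a' - a) / (v - u) -> b' = a' + h * (a - a') / (u - v) ->
  a * ((v - u - h) / (v - u) * (u - z - h))
  + a' * ((u - v - h) / (u - v) * (v - z - h))
  - (b * ((u - v - h) / (u - v) * (u - z))
     + b' * ((v - u - h) / (v - u) * (v - z))) = 0.
Proof.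
move=> n1 -> -> /=; field.
by rewrite n1 -oppr_eq0 opprB n1.
Qed.

(* s j exchanges u j and v j; S stands for a symmetrization absorbing it. *)
Variables (k0 be : nat) (u v : nat -> F).
Variables (s : nat -> {rmorphism F -> F}) (S : {additive F -> F}).
Hypothesis two_neq0 : 2%:R != 0 :> F.
Hypothesis sh : forall j, s j h = h.
Hypothesis su : forall j, (k0 <= j < be)%N -> s j (u j) = v j.
Hypothesis sv : forall j, (k0 <= j < be)%N -> s j (v j) = u j.
Hypothesis sui : forall i j, (k0 <= j < be)%N -> (i <= be)%N -> i != j ->
  s j (u i) = u i.
Hypothesis svi : forall i j, (k0 <= j < be)%N -> (i <= be)%N -> i != j ->
  s j (v i) = v i.
Hypothesis sC : forall i j, i != j -> forall x, s i (s j x) = s j (s i x).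
Hypothesis ss : forall j, (k0 <= j < be)%N -> forall x, s j (s j x) = x.
Hypothesis Ss : forall j, (k0 <= j < be)%N -> forall x, S (s j x) = S x.
Hypothesis uv : forall j, (k0 <= j < be)%N -> v j - u j != 0.

(** The head of level i is its interaction with itself and the factor from u i
    to the next level; the link adds the factor from the previous level to u i.
    In A the variables v lie to the right of the u, in B to their left. *)
Definition headA i := (v i - u i - h) / (v i - u i) * (u i - v i.+1 - h).
Definition headB i := (u i - v i - h) / (u i - v i) * (u i - v i.+1).
Definition linkA i := (v i.-1 - u i) * headA i.
Definition linkB i := (v i.-1 - u i - h) * headB i.

Lemma swap_avg_eq0 j (x : F) :
  (k0 <= j < be)%N -> S (x + s j x) = 0 -> S x = 0.
Proof.
move=> jr; rewrite raddfD Ss //= -mulr2n -mulr_natr => /eqP.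
by rewrite mulf_eq0 (negPf two_neq0) orbF => /eqP.
Qed.

Lemma swap_head k : (k0 <= k < be)%N ->
  s k (headA k) = (u k - v k - h) / (u k - v k) * (v k - v k.+1 - h)
  /\ s k (headB k) = (v k - u k - h) / (v k - u k) * (v k - v k.+1).
Proof.
move=> kr; have kbe : (k.+1 <= be)%N by case/andP: kr.
rewrite /headA /headB !(rmorphM, fmorphV, rmorphB) /= sh su // sv //.
by rewrite svi ?neq_ltn ?ltnSn ?orbT.
Qed.

Lemma swap_link k i : (k0 <= k < be)%N -> (k.+1 < i < be)%N ->
  s k (linkA i) = linkA i /\ s k (linkB i) = linkB i.
Proof.
move=> kr ir; rewrite /linkA /linkB /headA /headB.
rewrite !(rmorphM, fmorphV, rmorphB) /= sh sui ?[s k (v _)]svi //; lia.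
Qed.

(** Averaging over the exchange at level k replaces a and b by their successors
    a1 and b1 in the sense of [swap_step] and leaves the same statement one
    level further.  As the later exchanges fix a, the only pair still to be
    averaged on which a1 depends is the next one, as the induction requires. *)
Lemma chain_vanish k a b R :
  (k0 <= k < be)%N ->
  b = a + h * (s k a - a) / (v k - u k) ->
  (forall j, (k < j < be)%N -> s j a = a) ->
  (forall j, (k <= j < be)%N -> s j R = R) ->
  S (R * (a * (headA k * \prod_(k.+1 <= i < be) linkA i)
          - b * (headB k * \prod_(k.+1 <= i < be) linkB i))) = 0.
Proof.
have [r] := ubnP (be - k)%N.
elim: r k a b R => // r IH k a b R lebk kr bE ha hR.
have uvk := uv kr.
have [k0k kbe] := andP kr.
have bE' : s k b = s k a + h * (a - s k a) / (u k - v k).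
  by rewrite bE rmorphD !(rmorphM, fmorphV) !rmorphB /= sh ss // su // sv.
have [hA hB] := swap_head kr.
have sR : s k R = R by rewrite hR ?leqnn.
have sE x y : s k (R * (a * x - b * y)) = R * (s k a * s k x - s k b * s k y).
  by rewrite rmorphM rmorphB !rmorphM sR.
have sM x y : s k (x * y) = s k x * s k y by rewrite rmorphM.
apply: (swap_avg_eq0 kr).
have [kbe1|k1be] := leqP be k.+1.
  rewrite !big_geq // !mulr1 sE -mulrDr hA hB.
  by rewrite addrACA -opprD (swap_end _ uvk bE bE') mulr0 raddf0.
have k1r : (k0 <= k.+1 < be)%N by rewrite k1be (leq_trans k0k).
have uvk1 := uv k1r.
rewrite !(@big_ltn _ _ _ k.+1) //.
set PA := \prod_(_ <= _ < _) _; set PB := \prod_(_ <= _ < _) _.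
have sPA : s k PA = PA.
  by rewrite rmorph_prod; apply: eq_big_nat => i ir; case: (swap_link kr ir).
have sPB : s k PB = PB.
  by rewrite rmorph_prod; apply: eq_big_nat => i ir; case: (swap_link kr ir).
have shA : s k (headA k.+1) = headA k.+1.
  rewrite /headA !(rmorphM, fmorphV, rmorphB) /= sh !sui ?svi //; lia.
have shB : s k (headB k.+1) = headB k.+1.
  rewrite /headB !(rmorphM, fmorphV, rmorphB) /= sh !sui ?svi //; lia.
pose a1 := a * headA k * (v k - u k.+1) + s k (a * headA k * (v k - u k.+1)).
pose b1 := b * headB k * (v k - u k.+1 - h)
           + s k (b * headB k * (v k - u k.+1 - h)).
have -> : R * (a * (headA k * (linkA k.+1 * PA))
               - b * (headB k * (linkB k.+1 * PB)))
  + s k (R * (a * (headA k * (linkA k.+1 * PA))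
              - b * (headB k * (linkB k.+1 * PB))))
  = R * (a1 * (headA k.+1 * PA) - b1 * (headB k.+1 * PB)).
  have sl : s k (v k - u k.+1) = u k - u k.+1.
    by rewrite rmorphB /= sv // sui //; lia.
  have slh : s k (v k - u k.+1 - h) = u k - u k.+1 - h by rewrite rmorphB sl sh.
  rewrite sE /a1 /b1 /linkA /linkB /=.
  rewrite (sM (headA k)) (sM (headB k)) (sM _ PA) (sM _ PB).
  rewrite (sM _ (headA k.+1)) (sM _ (headB k.+1)).
  rewrite (sM (a * headA k)) (sM (b * headB k)) (sM a) (sM b).
  rewrite sPA sPB shA shB hA hB sl slh; ring.
have sk1 i : (k.+1 < i < be)%N -> s i a1 = a1.
  move=> ir; have ki : i != k by lia.
  have e : s i (a * headA k * (v k - u k.+1)) = a * headA k * (v k - u k.+1).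
    rewrite /headA !(rmorphM, fmorphV, rmorphB) /= sh !sui ?svi ?ha //; lia.
  by rewrite /a1 rmorphD sC // e.
apply: IH => //; first by lia.
- have k1k : k.+1 != k by lia.
  have e1 : s k (u k.+1) = u k.+1 by rewrite sui //; lia.
  have e2 : s k (v k.+1) = v k.+1 by rewrite svi //; lia.
  have e3 : s k.+1 (u k) = u k by rewrite sui //; lia.
  have e4 : s k.+1 (v k) = v k by rewrite svi //; lia.
  have e5 : s k.+1 a = a by rewrite ha //; lia.
  rewrite /b1 /a1 rmorphD [s k.+1 (s k _)]sC //.
  rewrite (sM (a * headA k)) (sM (b * headB k)) (sM a) (sM b) hA hB.
  rewrite /headA /headB.
  rewrite !(rmorphM, fmorphV, rmorphB) /= !sh (sv kr) !(e1, e2, e3, e4, e5).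
  rewrite (su k1r) (sv k1r) (su kr) (sv kr) !(e1, e2, e3, e4, e5).
  exact: (swap_step uvk uvk1 bE bE').
- by move=> j jr; apply: hR; lia.
Qed.
End SwapSums.

(** * The functions U written by positions *)

Section PositionForm.
Variables (F : fieldType) (N n : nat) (h : F).
Implicit Types (P : nat -> {set 'I_n}) (y : nat -> 'I_n -> F) (p q : 'I_n).

(** The factor between a variable a of some level at position p and a variable b
    of the next level at position q. *)
Definition cross (p q : nat) (a b : F) : F :=
  if (q < p)%N then a - b else if (p < q)%N then a - b - h else 1.

Definition ordpair (p q : nat) (a b : F) : F :=
  if (p < q)%N then (b - a - h) / (b - a) else 1.

Definition posU P y : F :=
  \prod_(1 <= j < N)
    ((\prod_(p in P j) \prod_(q in P j.+1) cross p q (y j p) (y j.+1 q))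
   * (\prod_(p in P j) \prod_(q in P j) ordpair p q (y j p) (y j q))).

(** The factors of posU that contain the variable w put at position p of level
    k.  Those between w and a variable already at p are 1, because [cross] and
    [ordpair] are 1 on equal positions; hence the factor depends on P and y only
    off p. *)
Definition insfactor P y (k : nat) p (w : F) : F :=
  (\prod_(q in P k.+1) cross p q w (y k.+1 q))
  * (\prod_(q in P k.-1) cross q p (y k.-1 q) w)
  * (\prod_(q in P k) (ordpair p q w (y k q) * ordpair q p (y k q) w)).

Definition insert_pos (k0 k1 : nat) p P : nat -> {set 'I_n} :=
  fun j => if (k0 <= j < k1)%N then p |: P j else P j.

Definition insert_val (k0 k1 : nat) p (u : nat -> F) y : nat -> 'I_n -> F :=
  fun j q => if (k0 <= j < k1)%N && (q == p) then u j else y j q.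

Lemma crosspp p a b : cross p p a b = 1.
Proof. by rewrite /cross ltnn. Qed.

Lemma ordpairpp p a b : ordpair p p a b = 1.
Proof. by rewrite /ordpair ltnn. Qed.

Lemma eq_posU P P' y y' :
  (forall j, (1 <= j <= N)%N -> P j = P' j) ->
  (forall j q, (1 <= j <= N)%N -> q \in P j -> y j q = y' j q) ->
  posU P y = posU P' y'.
Proof.
move=> eP ey; apply: eq_big_nat => j /andP[j1 jN].
have hj : (1 <= j <= N)%N by rewrite j1 ltnW.
have hj1 : (1 <= j.+1 <= N)%N by [].
rewrite -!eP //; congr (_ * _); apply: eq_bigr => p pj; apply: eq_bigr => q qj.
  by rewrite !ey.
by rewrite !ey.
Qed.

Lemma prod_eq_off p (A A' : {set 'I_n}) (f f' : 'I_n -> F) :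
  f p = 1 -> f' p = 1 ->
  (forall q, q != p -> (q \in A) = (q \in A')) ->
  (forall q, q != p -> q \in A -> f q = f' q) ->
  \prod_(q in A) f q = \prod_(q in A') f' q.
Proof.
move=> fp fp' eA ef; rewrite big_mkcond [RHS]big_mkcond; apply: eq_bigr => q _.
have [->|qp] := eqVneq q p; first by rewrite fp fp' !if_same.
by rewrite -eA //; case: ifP => // qA; apply: ef.
Qed.

Lemma eq_insfactor P P' y y' k p w :
  (forall j q, q != p -> (q \in P j) = (q \in P' j)) ->
  (forall j q, q != p -> q \in P j -> (k.-1 <= j <= k.+1)%N ->
     y j q = y' j q) ->
  insfactor P y k p w = insfactor P' y' k p w.
Proof.
move=> eP ey; rewrite /insfactor; congr (_ * _ * _).
- apply: (@prod_eq_off p) => [||q|q qp qP]; rewrite ?crosspp ?ey //.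
    exact: eP.
  by lia.
- apply: (@prod_eq_off p) => [||q|q qp qP]; rewrite ?crosspp ?ey //.
    exact: eP.
  by lia.
- apply: (@prod_eq_off p) => [||q|q qp qP]; rewrite ?ordpairpp ?mulr1 ?ey //.
    exact: eP.
  by lia.
Qed.

(** The condition on P 0 reflects that level 0 has no variables: the product
    [posU] starts at level 1, so it contains no factors between the levels 0
    and 1. *)
Lemma posU_insert1 P y P' y' k p :
  (1 <= k < N)%N -> P 0 = set0 -> p \notin P k ->
  (forall j, P' j = if j == k then p |: P j else P j) ->
  (forall j q, ~~ ((j == k) && (q == p)) -> y' j q = y j q) ->
  posU P' y' = posU P y * insfactor P y k p (y' k p).
Proof.
move=> /andP[k1 kN] P0 pk eP ey.
pose c j := \prod_(p in P j) \prod_(q in P j.+1) cross p q (y j p) (y j.+1 q).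
pose g j := \prod_(p in P j) \prod_(q in P j) ordpair p q (y j p) (y j q).
pose w := y' k p.
pose I1 := \prod_(q in P k.+1) cross p q w (y k.+1 q).
pose I2 := \prod_(q in P k.-1) cross q p (y k.-1 q) w.
pose I3 := \prod_(q in P k) (ordpair p q w (y k q) * ordpair q p (y k q) w).
have yk q : q \in P k -> y' k q = y k q.
  by move=> qk; apply: ey; rewrite eqxx; apply: contraNneq pk => <-.
have yj j q : j != k -> y' j q = y j q by move=> jk; rewrite ey // (negPf jk).
rewrite /posU.
rewrite (eq_big_nat _ _ (F2 := fun j => (c j * g j)
    * (((if j == k then I1 else 1) * (if j == k.-1 then I2 else 1))
       * (if j == k then I3 else 1)))); last first.
  move=> j /andP[j1 jN].
  have -> : \prod_(p0 in P' j) \prod_(q in P' j.+1)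
              cross p0 q (y' j p0) (y' j.+1 q)
     = c j * ((if j == k then I1 else 1) * (if j == k.-1 then I2 else 1)).
    have [jk|jk] := eqVneq j k.
      rewrite !eP jk eqxx -[k.+1 == k]negbK neq_ltn ltnSn orbT /= big_setU1 //=.
      have -> : (k == k.-1) = false by lia.
      rewrite mulr1 mulrC; congr (_ * _).
        apply: eq_bigr => q qk; apply: eq_bigr => r rk.
        by rewrite yk // yj //; lia.
      by apply: eq_bigr => r rk; rewrite (yj k.+1) //; lia.
    rewrite !eP (negPf jk) mul1r.
    have [jk1|jk1] := eqVneq j k.-1.
      have jk1' : j.+1 = k by lia.
      rewrite jk1' eqxx /c /I2 -jk1 jk1' -big_split /=.
      apply: eq_bigr => q qj; rewrite big_setU1 //= mulrC -/w (yj _ _ jk).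
      by congr (_ * _); apply: eq_bigr => r rk; rewrite yk.
    have -> : (j.+1 == k) = false by lia.
    rewrite mulr1; apply: eq_bigr => q qj; apply: eq_bigr => r rk.
    by rewrite !yj //; lia.
  have -> : \prod_(p0 in P' j) \prod_(q in P' j) ordpair p0 q (y' j p0) (y' j q)
     = g j * (if j == k then I3 else 1).
    have [jk|jk] := eqVneq j k.
      rewrite !eP jk eqxx big_setU1 //= big_setU1 //= ordpairpp mul1r.
      rewrite /I3 big_split /= mulrCA; congr (_ * _).
        by apply: eq_bigr => q qk; rewrite (yk q).
      rewrite mulrC /g -big_split /=; apply: eq_bigr => q qk.
      rewrite big_setU1 //= (yk q) //; congr (_ * _).
      by apply: eq_bigr => r rk; rewrite (yk r).
    rewrite !eP (negPf jk) mulr1.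
    apply: eq_bigr => q qj; apply: eq_bigr => r rj.
    by rewrite !yj.
  ring.
rewrite big_split /=; congr (_ * _).
rewrite !big_split /= -!big_mkcond /= !big_nat1_eq k1 kN /=.
rewrite /insfactor -/w -/I1 -/I2 -/I3; congr (_ * _ * _).
case: ifP => // k2; rewrite /I2 (_ : k.-1 = 0)%N ?P0 ?big_set0 //; lia.
Qed.

(** Inserting p at consecutive levels, one level at a time: the new variables at
    neighbouring levels have the same position and so do not interact. *)
Lemma posU_insert P y k0 k1 p (u : nat -> F) :
  (1 <= k0 <= k1)%N -> (k1 <= N)%N -> P 0 = set0 ->
  (forall j, (k0 <= j < k1)%N -> p \notin P j) ->
  posU (insert_pos k0 k1 p P) (insert_val k0 k1 p u y)
  = posU P y * \prod_(k0 <= i < k1) insfactor P y i p (u i).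
Proof.
move=> /andP[k0_gt0]; elim: k1 => [|k1 IH]; first by lia.
rewrite leq_eqVlt => /orP[/eqP -> _ _ _|].
  rewrite big_geq // mulr1; apply: eq_posU => [j|j q] _.
    by rewrite /insert_pos; case: ifP => //; lia.
  by rewrite /insert_val; case: ifP => //; lia.
rewrite ltnS => k01 k1N P0 pP.
rewrite big_nat_recr //= mulrA -IH //; last 2 first.
- by lia.
- by move=> j jr; apply: pP; lia.
have uk1 : insert_val k0 k1.+1 p u y k1 p = u k1.
  by rewrite /insert_val eqxx k01 ltnSn.
rewrite (@posU_insert1 (insert_pos k0 k1 p P) (insert_val k0 k1 p u y)
           _ _ k1 p) //.
- congr (_ * _); rewrite uk1; apply: eq_insfactor => [j q qp|j q qp _ _].
    by rewrite /insert_pos; case: ifP; rewrite // !inE (negPf qp).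
  by rewrite /insert_val (negPf qp) andbF.
- by lia.
- by rewrite /insert_pos; case: ifP => //; lia.
- by rewrite /insert_pos ltnn andbF pP // k01 ltnSn.
- move=> j; rewrite /insert_pos; have [->|jk] := eqVneq j k1.
    by rewrite k01 ltnSn ltnn andbF.
  by congr (if _ then _ else _); lia.
- move=> j q; rewrite /insert_val.
  case: (q == p); rewrite ?andbF ?andbT // => jk.
  by congr (if _ then _ else _); lia.
Qed.

Lemma rmorph_cross (f : {rmorphism F -> F}) p q a b :
  f h = h -> f (cross p q a b) = cross p q (f a) (f b).
Proof.
move=> fh; rewrite /cross; case: ifP => _; first by rewrite rmorphB.
by case: ifP => _; rewrite ?rmorph1 // !rmorphB fh.
Qed.

Lemma rmorph_ordpair (f : {rmorphism F -> F}) p q a b :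
  f h = h -> f (ordpair p q a b) = ordpair p q (f a) (f b).
Proof.
move=> fh; rewrite /ordpair.
by case: ifP; rewrite ?rmorph1 // fmorph_div !rmorphB fh.
Qed.

Lemma rmorph_posU (f : {rmorphism F -> F}) P y :
  f h = h -> f (posU P y) = posU P (fun j q => f (y j q)).
Proof.
move=> fh; rewrite /posU rmorph_prod; apply: eq_bigr => j _; rewrite rmorphM.
congr (_ * _); rewrite rmorph_prod; apply: eq_bigr => p _;
  rewrite rmorph_prod; apply: eq_bigr => q _.
  exact: rmorph_cross.
exact: rmorph_ordpair.
Qed.

Lemma rmorph_insfactor (f : {rmorphism F -> F}) P y k p w :
  f h = h ->
  f (insfactor P y k p w) = insfactor P (fun j q => f (y j q)) k p (f w).
Proof.
move=> fh; rewrite /insfactor !rmorphM !rmorph_prod; congr (_ * _ * _);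
  by apply: eq_bigr => q _; rewrite ?rmorphM ?rmorph_cross ?rmorph_ordpair.
Qed.

(** The factors between a variable w of level i and all the variables of y, when
    w is placed just before the position k.  Unlike in [insfactor], no position
    is level with w: a variable at k lies to the right of w. *)
Definition cut (k : nat) P y (i : nat) (w : F) : F :=
  (\prod_(q in P i.-1)
      (if (q < k)%N then y i.-1 q - w - h else y i.-1 q - w))
  * (\prod_(q in P i.+1)
      (if (q < k)%N then w - y i.+1 q else w - y i.+1 q - h))
  * (\prod_(q in P i) (if (q < k)%N then (w - y i q - h) / (w - y i q)
                        else (y i q - w - h) / (y i q - w))).

Lemma prod_pick p (A : {set 'I_n}) (f g : 'I_n -> F) (c : F) :
  g p = 1 -> f p = c -> (forall q, q != p -> f q = g q) ->
  \prod_(q in A) f q = \prod_(q in A) g q * (if p \in A then c else 1).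
Proof.
move=> gp fp fg.
have -> : (if p \in A then c else 1) = \prod_(q in A) (if q == p then c else 1).
  rewrite -big_mkcondr; case: ifP => pA; last first.
    by rewrite big_pred0 // => q; case: eqVneq => [->|]; rewrite ?pA ?andbF.
  rewrite (big_pred1 p) // => q /=.
  by case: eqVneq => [->|]; rewrite ?pA ?andbF.
rewrite -big_split /=; apply: eq_bigr => q _.
by case: eqVneq => [->|qp]; rewrite ?gp ?fp ?mul1r // mulr1 fg.
Qed.

(** Off p, lying left of the cut at p or at p.+1 is the same as preceding p; so
    the two cuts on either side of p differ from the insertion at p only by
    the factors with the variables at p. *)
Lemma cut_before P y i p w :
  cut p P y i w = insfactor P y i p w *
    ((if p \in P i.-1 then y i.-1 p - w else 1)
     * (if p \in P i.+1 then w - y i.+1 p - h else 1)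
     * (if p \in P i then (y i p - w - h) / (y i p - w) else 1)).
Proof.
have AC (a b c x z t : F) : a * x * (b * z) * (c * t) = b * a * c * (x * z * t).
  by ring.
rewrite /cut /insfactor.
rewrite (@prod_pick p (P i.-1)
  (fun q => if (q < p)%N then y i.-1 q - w - h else y i.-1 q - w)
  (fun q => cross q p (y i.-1 q) w) (y i.-1 p - w)).
rewrite (@prod_pick p (P i.+1)
  (fun q => if (q < p)%N then w - y i.+1 q else w - y i.+1 q - h)
  (fun q => cross p q w (y i.+1 q)) (w - y i.+1 p - h)).
rewrite (@prod_pick p (P i)
  (fun q => if (q < p)%N then (w - y i q - h) / (w - y i q)
            else (y i q - w - h) / (y i q - w))
  (fun q => ordpair p q w (y i q) * ordpair q p (y i q) w)
  ((y i p - w - h) / (y i p - w))).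
exact: AC.
all: rewrite ?crosspp ?ordpairpp ?mulr1 ?ltnn // => q qp.
- rewrite /ordpair; case: ltngtP => pq; rewrite ?mulr1 ?mul1r //.
  by case/eqP: qp; apply: val_inj.
- rewrite /cross; case: ltngtP => pq //.
  by case/eqP: qp; apply: val_inj.
- rewrite /cross; case: ltngtP => pq //.
  by case/eqP: qp; apply: val_inj.
Qed.

Lemma cut_after P y i p w :
  cut p.+1 P y i w = insfactor P y i p w *
    ((if p \in P i.-1 then y i.-1 p - w - h else 1)
     * (if p \in P i.+1 then w - y i.+1 p else 1)
     * (if p \in P i then (w - y i p - h) / (w - y i p) else 1)).
Proof.
have AC (a b c x z t : F) : a * x * (b * z) * (c * t) = b * a * c * (x * z * t).
  by ring.
rewrite /cut /insfactor.
rewrite (@prod_pick p (P i.-1)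
  (fun q => if (q < p.+1)%N then y i.-1 q - w - h else y i.-1 q - w)
  (fun q => cross q p (y i.-1 q) w) (y i.-1 p - w - h)).
rewrite (@prod_pick p (P i.+1)
  (fun q => if (q < p.+1)%N then w - y i.+1 q else w - y i.+1 q - h)
  (fun q => cross p q w (y i.+1 q)) (w - y i.+1 p)).
rewrite (@prod_pick p (P i)
  (fun q => if (q < p.+1)%N then (w - y i q - h) / (w - y i q)
            else (y i q - w - h) / (y i q - w))
  (fun q => ordpair p q w (y i q) * ordpair q p (y i q) w)
  ((w - y i p - h) / (w - y i p))).
exact: AC.
all: rewrite ?crosspp ?ordpairpp ?mulr1 ?ltnSn // => q qp; rewrite ltnS.
- rewrite /ordpair; case: ltngtP => pq; rewrite ?mulr1 ?mul1r //.
  by case/eqP: qp; apply: val_inj.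
- rewrite /cross; case: ltngtP => pq //.
  by case/eqP: qp; apply: val_inj.
- rewrite /cross; case: ltngtP => pq //.
  by case/eqP: qp; apply: val_inj.
Qed.
End PositionForm.

(** * Invariance of the symmetrization *)

Section Symmetrization.
Variables (C : fieldType) (N n : nat).
Local Notation F := (ratfun C N n).
Local Notation tv := (tvar C N n).
Implicit Types (g : F) (s t : 'S_n.+1) (lam : {ffun 'I_N -> nat}).

(** Reduces identities between compositions of substitutions to their effect on
    the variables, which generate the field over the constants. *)
Lemma ratfun_rmorph_ext (phi psi : {rmorphism F -> F}) :
  (forall c, phi (cst N n c) = psi (cst N n c)) ->
  (forall j a, (j <= N)%N -> (a <= n)%N -> phi (tv j a) = psi (tv j a)) ->
  phi =1 psi.
Proof.
move=> ec et g.
suff ep (p : {mpoly C[nvar N n]}) : phi (tofrac p) = psi (tofrac p).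
  by rewrite (fraction_div g) !(rmorphM, fmorphV) !ep.
elim/mpolyind: p => [|c m p _ _ IH]; first by rewrite !rmorph0.
rewrite !rmorphD IH; congr (_ + _).
rewrite -mul_mpolyC !rmorphM; congr (_ * _); first exact: ec.
rewrite mpolyXE_id !rmorph_prod; apply: eq_bigr => v _.
rewrite !rmorphXn; congr (_ ^+ _).
case/mxvec_indexP: v => i a.
have := et i a (ltn_ord i) (ltn_ord a).
by rewrite /tvar !inord_val.
Qed.

Lemma tvar_inj j a b : (a <= n)%N -> (b <= n)%N -> tv j a = tv j b -> a = b.
Proof.
move=> an bn /eqP; rewrite /tvar tofrac_eq => /eqP.
move/(congr1 (@mlead _ _)); rewrite !mleadXm => /eqP; rewrite eq_mnm1 => /eqP.
rewrite /vidx /mxvec_index => /cast_ord_inj/enum_rank_inj[/(congr1 val)].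
by rewrite /= !inordK.
Qed.

Lemma vsubstM j s t g : vsubst j t (vsubst j s g) = vsubst j (s * t)%g g.
Proof.
apply: (ratfun_rmorph_ext (phi := vsubst j t \o vsubst j s)
                          (psi := vsubst j (s * t)%g) _ _ g).
  by move=> c; rewrite /= !vsubst_cst.
move=> i a iN an /=; rewrite -(inordK an) !vsubst_tvar //.
by case: (i == j); rewrite ?permM.
Qed.

Lemma vsubstC i j s t g : i != j ->
  vsubst j t (vsubst i s g) = vsubst i s (vsubst j t g).
Proof.
move=> ij; apply: (ratfun_rmorph_ext (phi := vsubst j t \o vsubst i s)
                          (psi := vsubst i s \o vsubst j t) _ _ g).
  by move=> c; rewrite /= !vsubst_cst.
move=> k a kN an /=; rewrite -(inordK an) !vsubst_tvar //.
by have [->|//] := eqVneq k i; rewrite (negPf ij).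
Qed.

Lemma vsubst1 j g : vsubst j 1%g g = g.
Proof.
apply: (ratfun_rmorph_ext (phi := vsubst j 1%g) (psi := idfun) _ _ g)
  => [c|i a iN an].
  by rewrite /= vsubst_cst.
by rewrite /= -(inordK an) vsubst_tvar // perm1 if_same.
Qed.

Lemma Sym1_vsubst j k s g : perm_on [set a : 'I_n.+1 | (0 < a <= k)%N] s ->
  Sym1 j k (vsubst j s g) = Sym1 j k g.
Proof.
move=> sP; rewrite /Sym1 [RHS](reindex_inj (mulgI s)) /=.
apply: eq_big => [t|t _]; last by rewrite vsubstM.
apply/idP/idP => [tP|stP]; first exact: perm_onM.
by rewrite -(mulKg s t) perm_onM ?perm_onV.
Qed.

Lemma Sym1_vsubstC i j k s g : i != j ->
  Sym1 j k (vsubst i s g) = vsubst i s (Sym1 j k g).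
Proof.
by move=> ij; rewrite /Sym1 rmorph_sum; apply: eq_bigr => t _; rewrite vsubstC.
Qed.

(** The substitution commutes with the symmetrizations of the other levels until
    it meets that of its own level, which absorbs it. *)
Lemma Sym_vsubst lam j s g :
  (0 < j < N)%N -> perm_on [set a : 'I_n.+1 | (0 < a <= psum lam j)%N] s ->
  Sym lam (vsubst j s g) = Sym lam g.
Proof.
move=> jN sP; rewrite /Sym.
have: j \in iota 1 N.-1 by rewrite mem_iota; lia.
have := iota_uniq 1 N.-1.
elim: (iota _ _) => //= i l IH /andP[il ul]; rewrite inE => /orP[/eqP ji|jl].
  rewrite {}ji in sP *; rewrite -[RHS](@Sym1_vsubst _ _ s _ sP).
  congr (Sym1 _ _ _).
  elim: l il {IH ul} => //= k l IH; rewrite inE negb_or => /andP[ik il].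
  by rewrite IH // Sym1_vsubstC.
by rewrite IH.
Qed.

Fact Sym1_zmod j k : zmod_morphism (@Sym1 C N n j k).
Proof.
by move=> f g; rewrite /Sym1 -sumrB; apply: eq_bigr => s _; rewrite rmorphB.
Qed.

Fact Sym_zmod lam : zmod_morphism (@Sym C N n lam).
Proof.
move=> f g; rewrite /Sym; elim: (iota _ _) => //= j l ->; exact: Sym1_zmod.
Qed.

HB.instance Definition _ lam :=
  GRing.isZmodMorphism.Build F F (@Sym C N n lam) (Sym_zmod lam).

Lemma Sym_cst lam c g : Sym lam (cst N n c * g) = cst N n c * Sym lam g.
Proof.
rewrite /Sym; elim: (iota _ _) => //= j l ->.
rewrite /Sym1 mulr_sumr; apply: eq_bigr => s _.
by rewrite rmorphM /= vsubst_cst.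
Qed.
End Symmetrization.

(** * A position occupied below the level be *)

Section OccupiedPosition.
Variables (F : fieldType) (h : F) (N n al be M : nat) (p : 'I_n).
Variables (P : nat -> {set 'I_n}) (y : nat -> 'I_n -> F) (u : nat -> F).
Variables (s : nat -> {rmorphism F -> F}) (S : {additive F -> F}).
Hypotheses (al_gt0 : (0 < al)%N) (al_be : (al < be)%N) (beN : (be <= N)%N).
Hypotheses (M_gt0 : (0 < M)%N) (M_be : (M < be)%N).
Hypotheses (P0 : P 0 = set0) (pP : forall j, (p \in P j) = (M <= j)%N).
(* The levels having both a new variable u j and a variable y j p are those from
   k0 to be - 1. *)
Let k0 := maxn al M.
Hypothesis two_neq0 : 2%:R != 0 :> F.
Hypothesis sh : forall j, s j h = h.
Hypothesis sC : forall i j, i != j -> forall x, s i (s j x) = s j (s i x).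
Hypothesis sui : forall i j, (i <= N)%N -> i != j -> s j (u i) = u i.
Hypothesis syi : forall i j q, (i <= N)%N -> i != j -> s j (y i q) = y i q.
Hypothesis su : forall j, (k0 <= j < be)%N -> s j (u j) = y j p.
Hypothesis sy : forall j, (k0 <= j < be)%N -> s j (y j p) = u j.
Hypothesis syj : forall j q, (k0 <= j < be)%N -> q != p -> q \in P j ->
  s j (y j q) = y j q.
Hypothesis ss : forall j, (k0 <= j < be)%N -> forall x, s j (s j x) = x.
Hypothesis Ss : forall j, (k0 <= j < be)%N -> forall x, S (s j x) = S x.
Hypothesis uy : forall j, (k0 <= j < be)%N -> y j p - u j != 0.

(** Removing p from the levels k0, ..., be - 1 exhibits the product as one in
    which u_i and y i p enter those levels through the same insertion factor. *)
Lemma posU_insert_swap j : (k0 <= j < be)%N ->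
  let R := posU N h P y * \prod_(al <= i < be) insfactor h P y i p (u i) in
  s j R = R.
Proof.
move=> jr R.
have k0_gt0 : (0 < k0)%N by rewrite /k0; lia.
have alk0 : (al <= k0)%N by rewrite /k0; lia.
have k0be : (k0 < be)%N by rewrite /k0; lia.
pose P1 j := if (k0 <= j < be)%N then P j :\ p else P j.
have eqP1 i q : q != p -> (q \in P1 i) = (q \in P i).
  by move=> qp; rewrite /P1; case: ifP; rewrite // !inE qp.
have -> : R = posU N h P1 y * \prod_(al <= i < k0) insfactor h P y i p (u i)
    * \prod_(k0 <= i < be)
        (insfactor h P y i p (y i p) * insfactor h P y i p (u i)).
  rewrite /R; have -> : posU N h P y
      = posU N h P1 y * \prod_(k0 <= i < be) insfactor h P y i p (y i p).
    transitivity (posU N h (insert_pos k0 be p P1)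
                           (insert_val k0 be p (fun i => y i p) y)).
      apply: eq_posU => [i|i q] _.
        rewrite /insert_pos /P1; case ir: (k0 <= i < be)%N => //.
        by rewrite setD1K // pP; move: ir; rewrite /k0; lia.
      by rewrite /insert_val; case: ifP => // /andP[_ /eqP ->].
    rewrite posU_insert //; first last.
    - by move=> i ir; rewrite /P1 ir !inE eqxx.
    - by rewrite /P1 P0 leqNgt k0_gt0.
    - by rewrite k0_gt0 ltnW.
    congr (_ * _); apply: eq_bigr => i _; apply: eq_insfactor => //.
  by rewrite (big_cat_nat alk0 (ltnW k0be)) /= mulrACA -big_split.
have insE i w : (al <= i < be)%N ->
    s j (insfactor h P y i p w) = insfactor h P y i p (s j w).
  move=> ir; rewrite rmorph_insfactor //.
  apply: eq_insfactor => // k q qp qk kr.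
  have [kj|kj] := eqVneq k j; last by rewrite syi //; lia.
  by rewrite kj in qk *; apply: syj.
rewrite rmorphM [s j (posU _ _ _ _ * _)]rmorphM rmorph_posU // !rmorph_prod.
congr (_ * _ * _).
- apply: eq_posU => // i q /andP[i1 iN].
  have [->|ij] := eqVneq i j; last by rewrite syi.
  by rewrite /P1 jr !inE => /andP[qp qj]; rewrite syj.
- apply: eq_big_nat => i ir; rewrite insE; last lia.
  by rewrite sui //; lia.
- apply: eq_big_nat => i ir; rewrite [s j (_ * _)]rmorphM !insE; try by lia.
  have [->|ij] := eqVneq i j; first by rewrite su // sy // mulrC.
  by rewrite sui ?syi //; lia.
Qed.

Let v i := y i p.

(** The factors with the variables at p form the chain of [chain_vanish] from
    level k0 on.  Its initial coefficients a and b collect what comes before: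
    the factor between y (al-1) p and u al if M < al, the factor between u (M-1)
    and y M p if al < M, and 1 if M = al. *)
Lemma occupied_vanish :
  S (posU N h P y * (\prod_(al <= i < be) cut h p P y i (u i)
                     - \prod_(al <= i < be) cut h p.+1 P y i (u i))) = 0.
Proof.
have k0_gt0 : (0 < k0)%N by rewrite /k0; lia.
have alk0 : (al <= k0)%N by rewrite /k0; lia.
have k0be : (k0 < be)%N by rewrite /k0; lia.
have k0r : (k0 <= k0 < be)%N by rewrite leqnn.
pose EA i := (if p \in P i.-1 then v i.-1 - u i else 1)
     * (if p \in P i.+1 then u i - v i.+1 - h else 1)
     * (if p \in P i then (v i - u i - h) / (v i - u i) else 1).
pose EB i := (if p \in P i.-1 then v i.-1 - u i - h else 1)
     * (if p \in P i.+1 then u i - v i.+1 else 1)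
     * (if p \in P i then (u i - v i - h) / (u i - v i) else 1).
set I := fun i => insfactor h P y i p (u i).
have -> : \prod_(al <= i < be) cut h p P y i (u i)
    = \prod_(al <= i < be) I i * \prod_(al <= i < be) EA i.
  by rewrite -big_split; apply: eq_bigr => i _; exact: cut_before.
have -> : \prod_(al <= i < be) cut h p.+1 P y i (u i)
    = \prod_(al <= i < be) I i * \prod_(al <= i < be) EB i.
  by rewrite -big_split; apply: eq_bigr => i _; exact: cut_after.
rewrite -mulrBr mulrA.
have [a [b [-> -> ha hb]]] : exists a b,
  [/\ \prod_(al <= i < be) EA i
        = a * (headA h u v k0 * \prod_(k0.+1 <= i < be) linkA h u v i),
      \prod_(al <= i < be) EB i
        = b * (headB h u v k0 * \prod_(k0.+1 <= i < be) linkB h u v i),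
      forall j, (k0 < j < be)%N -> s j a = a &
      b = a + h * (s k0 a - a) / (v k0 - u k0)].
  have tail E L : (forall i, (k0 < i < be)%N -> E i = L i) ->
      \prod_(al <= i < be) E i
      = \prod_(al <= i < k0) E i * E k0 * \prod_(k0.+1 <= i < be) L i :> F.
    move=> eL; rewrite (big_cat_nat alk0 (ltnW k0be)) /= (big_ltn k0be) mulrA.
    by congr (_ * _); apply: eq_big_nat.
  have pT i : (k0 <= i)%N -> p \in P i by rewrite pP; rewrite /k0; lia.
  have eqA i : (k0 < i < be)%N -> EA i = linkA h u v i.
    by move=> ir; rewrite /EA !pT /linkA /headA; try lia; ring.
  have eqB i : (k0 < i < be)%N -> EB i = linkB h u v i.
    by move=> ir; rewrite /EB !pT /linkB /headB; try lia; ring.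
  rewrite (tail _ _ eqA) (tail _ _ eqB).
  pose fA := if p \in P k0.-1 then v k0.-1 - u k0 else 1.
  pose fB := if p \in P k0.-1 then v k0.-1 - u k0 - h else 1.
  have eA : EA k0 = fA * headA h u v k0.
    by rewrite /EA (pT k0) // (pT k0.+1) // -mulrA [X in _ * X]mulrC.
  have eB : EB k0 = fB * headB h u v k0.
    by rewrite /EB (pT k0) // (pT k0.+1) // -mulrA [X in _ * X]mulrC.
  rewrite {}eA {}eB.
  have uvk0 := uy k0r.
  exists (\prod_(al <= i < k0) EA i * fA), (\prod_(al <= i < k0) EB i * fB).
  rewrite !mulrA /fA /fB.
  have [leMal|ltalM] := leqP M al.
    have k0E : k0 = al by rewrite /k0; lia.
    have e0 E : \prod_(al <= i < al) E i = 1 :> F by rewrite big_geq.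
    rewrite k0E !e0 !mul1r pP; split=> //.
      move=> j jr; case: ifP; rewrite ?rmorph1 // rmorphB /= sui ?syi //; lia.
    case: ifP => M1; last by rewrite rmorph1 subrr mulr0 mul0r addr0.
    rewrite rmorphB /= syi; try lia.
    by rewrite -k0E su // -/(v k0) -/(v _); field; apply: uvk0.
  have k0E : k0 = M by rewrite /k0; lia.
  have Mpred : (al <= M.-1 < M)%N by lia.
  have pF i : (i < M)%N -> p \in P i = false by rewrite pP; lia.
  have pI i : (i < M)%N -> (p \in P i.+1) = (i == M.-1) by rewrite pP; lia.
  have -> : \prod_(al <= i < k0) EA i = u M.-1 - v M - h.
    rewrite k0E (eq_big_nat _ _ (F2 := fun i =>
      if i == M.-1 then u i - v i.+1 - h else 1)).
      by rewrite -big_mkcond big_nat1_eq Mpred prednK.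
    by move=> i ir; rewrite /EA pI ?pF ?mulr1 ?mul1r //; lia.
  have -> : \prod_(al <= i < k0) EB i = u M.-1 - v M.
    rewrite k0E (eq_big_nat _ _ (F2 := fun i =>
      if i == M.-1 then u i - v i.+1 else 1)).
      by rewrite -big_mkcond big_nat1_eq Mpred prednK.
    by move=> i ir; rewrite /EB pI ?pF ?mulr1 ?mul1r //; lia.
  rewrite pF ?mulr1; last by rewrite k0E; lia.
  split=> // [j jr|].
    by rewrite !rmorphB /= sh sui ?syi //; lia.
  rewrite !rmorphB /= sh sui; try lia.
  rewrite /v -{2 3 4 5 6}k0E sy // k0E.
  field; rewrite -k0E; exact: uvk0.
apply: (@chain_vanish F h k0 be u v s S) => //.
- by move=> i j jr ib ij; apply: sui => //; lia.
- by move=> i j jr ib ij; apply: syi => //; lia.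
- by move=> j jr; apply: posU_insert_swap.
Qed.
End OccupiedPosition.

(** * Ranks of positions and relabelling of variables *)

Section Rank.
Variable n : nat.
Implicit Types (A B : {set 'I_n}) (p q : 'I_n).

(** The label of the variable at position p of a level occupied by A.  For p not
    in A it is #|A| + 1, the first label not taken by A. *)
Definition rank A p : nat := (index p (enum A)).+1.

Lemma rank_le A p : p \in A -> (0 < rank A p <= #|A|)%N.
Proof. by move=> pA; rewrite /rank cardE index_mem mem_enum. Qed.

Lemma rank_notin A p : p \notin A -> rank A p = #|A|.+1.
Proof. by move=> pA; rewrite /rank memNindex ?mem_enum // cardE. Qed.

Lemma rank_le_max A p : (rank A p <= n)%N.
Proof.
rewrite -[n in (_ <= n)%N]card_ord; have [pA|pA] := boolP (p \in A).
  by have /andP[_ le] := rank_le pA; rewrite (leq_trans le) ?max_card.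
by rewrite rank_notin // -add1n -[1%N]/(true : nat) -pA -cardsU1 max_card.
Qed.

Lemma rank_inj A : {in A &, injective (rank A)}.
Proof. by move=> p q pA qA [/(index_inj p)]; apply; rewrite mem_enum. Qed.

Lemma rank_lt A p q : p \in A -> q \in A -> (rank A p < rank A q)%N = (p < q)%N.
Proof.
suff H : {in A &, forall p q : 'I_n, (rank A p < rank A q)%N -> (p < q)%N}.
  move=> pA qA; apply/idP/idP; first exact: H.
  apply: contraTT; rewrite -!leqNgt leq_eqVlt.
  case/orP=> [/eqP/(rank_inj qA pA) -> //|].
  by move/(H _ _ qA pA)/ltnW.
have srt : sorted (fun p q : 'I_n => p < q)%N (enum A).
  have := iota_ltn_sorted 0 n; rewrite -val_enum_ord sorted_map => srt.
  rewrite /enum_mem; apply: sorted_filter => //; last by rewrite enumT in srt.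
  by move=> a b c; apply: ltn_trans.
move=> {}p {}q pA qA; rewrite ltnS.
apply: (sorted_ltn_index _ srt); rewrite ?mem_enum //.
by move=> a b c; apply: ltn_trans.
Qed.

Lemma big_rank (R : Type) (idx : R) (op : Monoid.com_law idx) A
    (G : nat -> nat -> R) :
  \big[op/idx]_(1 <= a < #|A|.+1) G (kth A a) a
  = \big[op/idx]_(p in A) G p (rank A p).
Proof.
have [->|[p0 _]] := set_0Vmem A; first by rewrite cards0 big_geq // big_set0.
rewrite big_add1 /= -(big_enum _ _ _ (fun p => G p (rank A p))) /=.
rewrite (big_nth p0) -cardE; apply: eq_big_nat => i /andP[_ iA].
have iA' : (i < size (enum A))%N by rewrite -cardE.
by rewrite /kth /rank (nth_map p0) //= index_uniq ?enum_uniq.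
Qed.

End Rank.

Section Labels.
Variables (C : fieldType) (N n : nat) (h : C).
Local Notation F := (ratfun C N n).
Local Notation tv := (tvar C N n).
Local Notation H := (cst N n h).
Implicit Types (lam : {ffun 'I_N -> nat}) (I J : {ffun 'I_N -> {set 'I_n}}).

Lemma U_posU lam I :
  (forall j, (1 <= j <= N)%N -> psum lam j = #|punion I j|) ->
  U h lam I = posU N H (punion I) (fun j p => tv j (rank (punion I j) p)).
Proof.
move=> sz; apply: eq_big_nat => j jN.
have szj : psum lam j = #|punion I j| by rewrite sz; lia.
have szj1 : psum lam j.+1 = #|punion I j.+1| by rewrite sz; lia.
rewrite szj szj1 /ielt.
set A := punion I j; set B := punion I j.+1.
pose inner (p a : nat) :=
 (\prod_(q in B) cross H p q (tv j a) (tv j.+1 (rank B q)))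
  * \prod_(q in A) (if (a < rank A q)%N
       then (tv j (rank A q) - tv j a - H) / (tv j (rank A q) - tv j a) else 1).
transitivity (\prod_(1 <= a < #|A|.+1) inner (kth A a) a).
  apply: eq_big_nat => a _; rewrite /inner.
  rewrite -(big_rank _ B (fun q b => cross H (kth A a) q (tv j a) (tv j.+1 b))).
  rewrite -(big_rank _ A (fun q b => if (a < b)%N
       then (tv j b - tv j a - H) / (tv j b - tv j a) else 1)).
  congr (_ * _).
    rewrite big_mkcond [X in _ * X]big_mkcond -big_split /=.
    apply: eq_bigr => b _; rewrite /cross.
    by case: ltngtP; rewrite ?mulr1 ?mul1r.
  by rewrite (big_nat_widenl _ 1) //= big_mkcond.
rewrite (big_rank _ A inner) /inner big_split /=.
congr (_ * _).
apply: eq_bigr => p pA; apply: eq_bigr => q qA.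
by rewrite rank_lt.
Qed.

(** In products of the shape of A and B, the factor with the last variable of
    level al - 1, and the one with the last variable of level be, complete the
    ranges at the two ends: among the levels al - 1, ..., be, exactly those from
    al to be - 1 have one variable more than P has positions. *)
Lemma prod_labels (P : nat -> {set 'I_n}) (L : nat -> nat) al be
    (phi psi chi : F -> F -> F) :
  (0 < al < be)%N ->
  (0 < L be)%N ->
  (forall j, (al.-1 <= j <= be)%N -> L j = (#|P j| + (al <= j < be))%N) ->
  (if L al.-1 == 0%N then 1 else phi (tv al.-1 (L al.-1)) (tv al (L al)))
  * (\prod_(al <= i < be) \prod_(1 <= a < L i.-1)
       phi (tv i.-1 a) (tv i (L i)))
  * psi (tv be.-1 (L be.-1)) (tv be (L be))
  * (\prod_(al <= i < be) \prod_(1 <= a < L i.+1)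
       psi (tv i (L i)) (tv i.+1 a))
  * (\prod_(al <= i < be) \prod_(1 <= a < L i) chi (tv i a) (tv i (L i)))
  = \prod_(al <= i < be)
      ((\prod_(q in P i.-1) phi (tv i.-1 (rank (P i.-1) q)) (tv i (L i)))
       * (\prod_(q in P i.+1) psi (tv i (L i)) (tv i.+1 (rank (P i.+1) q)))
       * (\prod_(q in P i) chi (tv i (rank (P i) q)) (tv i (L i)))).
Proof.
move=> /andP[al_gt0 al_be] Lbe hL; rewrite !big_split /=.
have e1 :
  (if L al.-1 == 0%N then 1 else phi (tv al.-1 (L al.-1)) (tv al (L al)))
  * (\prod_(al <= i < be) \prod_(1 <= a < L i.-1) phi (tv i.-1 a) (tv i (L i)))
  = \prod_(al <= i < be) \prod_(q in P i.-1)
      phi (tv i.-1 (rank (P i.-1) q)) (tv i (L i)).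
  rewrite !(big_ltn al_be) mulrA; congr (_ * _).
    rewrite -(big_rank _ (P al.-1)
                (fun q a => phi (tv al.-1 a) (tv al (L al)))).
    have -> : L al.-1 = #|P al.-1| by rewrite hL; lia.
    case: #|_| => [|k] /=; first by rewrite !big_geq ?mulr1.
    by rewrite [RHS]big_nat_recr //= mulrC.
  apply: eq_big_nat => i ir.
  rewrite -(big_rank _ (P i.-1) (fun q a => phi (tv i.-1 a) (tv i (L i)))).
  by have -> : L i.-1 = #|P i.-1|.+1 by rewrite hL; lia.
have e2 : psi (tv be.-1 (L be.-1)) (tv be (L be))
  * (\prod_(al <= i < be) \prod_(1 <= a < L i.+1) psi (tv i (L i)) (tv i.+1 a))
  = \prod_(al <= i < be) \prod_(q in P i.+1)
      psi (tv i (L i)) (tv i.+1 (rank (P i.+1) q)).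
  case: be al_be Lbe hL {e1} => // b al_b Lb1 hL.
  have al_le_b : (al <= b)%N by [].
  rewrite !(big_nat_recr _ _ _ al_le_b) /= mulrCA; congr (_ * _).
    apply: eq_big_nat => i ir.
    rewrite -(big_rank _ (P i.+1) (fun q a => psi (tv i (L i)) (tv i.+1 a))).
    by have -> : L i.+1 = #|P i.+1|.+1 by rewrite hL; lia.
  rewrite -(big_rank _ (P b.+1) (fun q a => psi (tv b (L b)) (tv b.+1 a))).
  have Lb : L b.+1 = #|P b.+1| by rewrite hL; lia.
  rewrite -Lb; case: (L b.+1) Lb1 => // k _.
  by rewrite [RHS]big_nat_recr //= mulrC.
rewrite e1 -[_ * psi _ _ * _]mulrA e2; congr (_ * _).
apply: eq_big_nat => i ir.
rewrite -(big_rank _ (P i) (fun q a => chi (tv i a) (tv i (L i)))).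
by have -> : L i = #|P i|.+1 by rewrite hL; lia.
Qed.

Lemma card_labels k : (k <= n)%N -> #|[set a : 'I_n.+1 | (0 < a <= k)%N]| = k.
Proof.
move=> kn; rewrite -[RHS]card_ord.
rewrite -(card_imset _ (f := fun i : 'I_k => inord i.+1 : 'I_n.+1)).
  apply: eq_card => a; rewrite inE; apply/idP/imsetP => [ar|[i _ ->]].
    have ik : (a.-1 < k)%N by lia.
    exists (Ordinal ik) => //; apply: val_inj; rewrite /= inordK; lia.
  by have ik := ltn_ord i; rewrite inordK; lia.
move=> i i'; have ik := ltn_ord i; have i'k := ltn_ord i'.
move/(congr1 val); rewrite /= !inordK; try lia.
by move=> [/val_inj].
Qed.

(** An injective labelling of A by labels up to #|A| is onto them, so that
    carrying r to r' determines the permutation. *)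
Lemma relabel_perm (A : {set 'I_n}) (r r' : 'I_n -> nat) :
  {in A &, injective r} -> {in A &, injective r'} ->
  (forall p, p \in A -> (0 < r p <= #|A|)%N) ->
  (forall p, p \in A -> (0 < r' p <= #|A|)%N) ->
  exists s : 'S_n.+1, perm_on [set a : 'I_n.+1 | (0 < a <= #|A|)%N] s
    /\ forall p, p \in A -> s (inord (r p)) = inord (r' p).
Proof.
move=> ri ri' rA rA'.
have An : (#|A| <= n)%N by rewrite -[n in (_ <= n)%N]card_ord max_card.
set B := [set a | _].
have onto a : a \in B -> exists2 p, p \in A & a = inord (r p).
  suff /setP e : [set inord (r p) | p in A] = B :> {set 'I_n.+1}.
    by rewrite -e => /imsetP.
  apply/eqP; rewrite eqEcard; apply/andP; split.
    apply/subsetP => b /imsetP[p pA ->].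
    by rewrite inE; have rp := rA p pA; rewrite inordK; lia.
  rewrite card_labels // card_in_imset // => p q pA qA /(congr1 val).
  have := rA p pA; have := rA q qA => h1 h2.
  by rewrite /= !inordK; [apply: ri| lia| lia].
pose f (a : 'I_n.+1) : 'I_n.+1 :=
  if [pick p in A | inord (r p) == a] is Some p then inord (r' p) else a.
have fr p : p \in A -> f (inord (r p)) = inord (r' p).
  move=> pA; rewrite /f; case: pickP => [q /andP[qA /eqP /(congr1 val)]|/(_ p)].
    have := rA p pA; have := rA q qA => h1 h2.
    rewrite /= !inordK; try lia.
    by move/(ri _ _ qA pA) ->.
  by rewrite pA eqxx.
have fo a : a \notin B -> f a = a.
  move=> aB; rewrite /f; case: pickP => // q /andP[qA /eqP e].
  case/negP: aB; rewrite -e inE; have rq := rA q qA; rewrite inordK; lia.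
have fB a : (f a \in B) = (a \in B).
  have [aB|aB] := boolP (a \in B); last by rewrite fo // (negPf aB).
  have [p pA ->] := onto a aB; rewrite fr // inE.
  by have rp := rA' p pA; rewrite inordK; lia.
have fi : injective f.
  move=> a b fab; have [aB|aB] := boolP (a \in B); last first.
    have bB : b \notin B by rewrite -fB -fab fB.
    by rewrite fo // fo // in fab.
  have bB : b \in B by rewrite -fB -fab fB.
  move: fab; have [p pA ->] := onto a aB; have [q qA ->] := onto b bB.
  rewrite !fr // => /(congr1 val).
  have := rA' p pA; have := rA' q qA => h1 h2.
  rewrite /= !inordK; try lia.
  by move/(ri' _ _ pA qA) ->.
exists (perm fi); split; last by move=> p pA; rewrite permE fr.
apply/subsetP => a; rewrite inE permE; apply: contraR => aB.
by rewrite fo.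
Qed.

Lemma vsubst_tvar_neq i j (s : 'S_n.+1) a :
  (i <= N)%N -> (a <= n)%N -> i != j -> vsubst j s (tv i a) = tv i a.
Proof.
move=> iN an ij.
by rewrite -(inordK (an : a < n.+1)%N) vsubst_tvar // (negPf ij).
Qed.

Lemma vsubst_tvar_eq j (s : 'S_n.+1) a b :
  (j <= N)%N -> (a <= n)%N -> (b <= n)%N ->
  s (inord a) = inord b -> vsubst j s (tv j a) = tv j b.
Proof.
move=> jN an bn sab.
by rewrite -(inordK (an : a < n.+1)%N) vsubst_tvar // eqxx sab inordK.
Qed.

(** Only the last level, whose variables are not symmetrized, must keep its
    labels.  The proof changes the labels level by level. *)
Lemma Sym_relabel lam (P : nat -> {set 'I_n}) (r r' : nat -> 'I_n -> nat) :
  (0 < N)%N -> (forall j, (0 < j < N)%N -> psum lam j = #|P j|) ->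
  (forall j, (0 < j < N)%N -> {in P j &, injective (r j)}) ->
  (forall j, (0 < j < N)%N -> {in P j &, injective (r' j)}) ->
  (forall j p, (0 < j <= N)%N -> p \in P j -> (0 < r j p <= #|P j|)%N) ->
  (forall j p, (0 < j <= N)%N -> p \in P j -> (0 < r' j p <= #|P j|)%N) ->
  (forall p, p \in P N -> r N p = r' N p) ->
  Sym lam (posU N H P (fun j p => tv j (r j p)))
  = Sym lam (posU N H P (fun j p => tv j (r' j p))).
Proof.
move=> N_gt0 sz ri ri' rP rP' rN.
have Pn j : (#|P j| <= n)%N by rewrite -[n in (_ <= n)%N]card_ord max_card.
pose rr k j p := if (j < k)%N then r' j p else r j p.
suff st k : (k < N)%N -> Sym lam (posU N H P (fun j p => tv j (r j p)))
    = Sym lam (posU N H P (fun j p => tv j (rr k.+1 j p))).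
  have NK : N.-1.+1 = N by rewrite prednK.
  rewrite (st N.-1) ?NK //; congr (Sym _ _); apply: eq_posU => // j q jr qj.
  rewrite /rr; case: ifP => // jN; have e : j = N by lia.
  by rewrite e in qj *; rewrite rN.
elim: k => [|k IH] kN.
  congr (Sym _ _); apply: eq_posU => // j q /andP[j0 _] _.
  by rewrite /rr ltnS leqn0 (gtn_eqF j0).
rewrite IH; last exact: ltnW.
have k1r : (0 < k.+1 < N)%N by [].
have k1r' : (0 < k.+1 <= N)%N by lia.
have [s [sP sr]] := relabel_perm (ri _ k1r) (ri' _ k1r)
  (fun p => rP _ p k1r') (fun p => rP' _ p k1r').
rewrite -sz // in sP.
rewrite -(Sym_vsubst _ k1r sP); congr (Sym _ _).
rewrite rmorph_posU; last exact: vsubst_cst.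
apply: eq_posU => // j q jr qj.
have b1 := rP j q jr qj; have b2 := rP' j q jr qj; have b3 := Pn j.
have [jk|jk] := eqVneq j k.+1.
  rewrite /= jk in qj b1 b2 b3 *; rewrite /rr ltnn ltnSn.
  apply: vsubst_tvar_eq; try lia; exact: sr.
rewrite /= vsubst_tvar_neq //; try (by lia).
  by rewrite /rr [in RHS]ltnS [in RHS]leq_eqVlt (negPf jk).
rewrite /rr; case: ifP; lia.
Qed.

End Labels.

(** * The contribution of each position *)

Section Insertion.
Variables (C : fieldType) (N n : nat) (h : C).
Variables (lam : {ffun 'I_N -> nat}) (al be : 'I_N).
Variable (J : {ffun 'I_N -> {set 'I_n}}).
Hypothesis two_neq0 : 2%:R != 0 :> C.
Hypothesis lam_sum : (\sum_(i < N) lam i = n)%N.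
Hypothesis al_lt_be : (al < be)%N.
Hypothesis lam_al : (1 <= lam al)%N.
Hypothesis J_part : J \in opart n (shift lam al be).
Local Notation F := (ratfun C N n).
Local Notation tv := (tvar C N n).
Local Notation H := (cst N n h).
Let P := punion J.
Let L := psum lam.
Let y j p := tv j (rank (P j) p).
Let u j := tv j (L j).

Lemma card_part i : #|J i| = shift lam al be i.
Proof.
by move: J_part; rewrite inE => /and3P[/forallP/(_ i)/eqP].
Qed.

Lemma part_of p : exists m : 'I_N, forall i, (p \in J i) = (i == m).
Proof.
move: J_part; rewrite inE => /and3P[_ dJ /eqP cJ].
have: p \in \bigcup_j J j by rewrite cJ inE.
case/bigcupP=> m _ pm; exists m => i; have [->|im] := eqVneq i m => //.
move/forallP: dJ => /(_ i)/forallP/(_ m); rewrite im /= => /pred0P/(_ p) /=.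
by rewrite pm andbT.
Qed.

Lemma mem_punion p (m : 'I_N) j :
  (forall i, (p \in J i) = (i == m)) -> (p \in P j) = (m < j)%N.
Proof.
move=> pm; apply/bigcupP/idP => [[i ij]|mj]; first by rewrite pm => /eqP <-.
by exists m => //; rewrite pm.
Qed.

Lemma psum_shift j : psum lam j = (psum (shift lam al be) j + (al < j <= be))%N.
Proof.
have sum1 (k : 'I_N) : (\sum_(i < N | (i < j)%N) (i == k) = (k < j))%N.
  rewrite big_mkcond (bigD1 k) //= eqxx big1; first by case: ifP.
  by move=> i /negPf ->; rewrite if_same.
suff : (psum lam j + (be < j) = psum (shift lam al be) j + (al < j))%N by lia.
rewrite -!sum1 /psum -!big_split /=; apply: eq_bigr => i _.
rewrite ffunE; have [->|ia] := eqVneq i al.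
  have -> : (al == be) = false by apply/negbTE; rewrite neq_ltn al_lt_be.
  by move: lam_al; lia.
by case: eqP => _; lia.
Qed.

Lemma card_punion j : #|P j| = psum (shift lam al be) j.
Proof.
rewrite /psum -sum1_card big_mkcond /=.
transitivity (\sum_(p : 'I_n) \sum_(i < N | (i < j)%N) (p \in J i))%N.
  apply: eq_bigr => p _; have [m pm] := part_of p.
  rewrite (mem_punion j pm) big_mkcond (bigD1 m) //= pm eqxx big1.
    by case: ifP.
  by move=> i /negPf im; rewrite pm im if_same.
rewrite exchange_big; apply: eq_bigr => i _.
rewrite -card_part -sum1_card [RHS]big_mkcond.
by apply: eq_bigr => p _; case: (p \in _).
Qed.

Lemma L_card j : L j = (#|P j| + (al.+1 <= j < be.+1))%N.
Proof. by rewrite /L psum_shift card_punion ltnS. Qed.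

Lemma L_le j : (L j <= n)%N.
Proof.
by rewrite /L /psum -lam_sum big_mkcond leq_sum // => i _; case: ifP.
Qed.

Lemma al_neq_be : (al == be) = false.
Proof. by apply/negbTE; rewrite neq_ltn al_lt_be. Qed.

Lemma L_be_gt0 : (0 < L be.+1)%N.
Proof.
rewrite /L /psum (bigD1 al) /=; last by rewrite ltnS ltnW.
by rewrite addn_gt0 lam_al.
Qed.

Lemma punion0 : P 0 = set0.
Proof.
apply/setP => p; have [m pm] := part_of p.
by rewrite (mem_punion 0 pm) inE.
Qed.

Definition moved (x : {set 'I_n}) : {ffun 'I_N -> {set 'I_n}} :=
  [ffun i => if i == be then J i :\: x else if i == al then J i :|: x else J i].

Lemma sum_moved (f : {ffun 'I_N -> {set 'I_n}} -> F) :
  \sum_(1 <= b < (lam be).+2) f (move J be al b)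
  = \sum_(p in J be) f (moved [set p]).
Proof.
have -> : (lam be).+2 = #|J be|.+1.
  by rewrite card_part ffunE eqxx eq_sym al_neq_be.
rewrite (big_rank _ (J be) (fun k _ => f (moved [set q in J be | val q == k]))).
apply: eq_bigr => p pJ; congr (f (moved _)); apply/setP => q.
by rewrite !inE; apply/andP/eqP => [[_ /eqP/val_inj]|->].
Qed.

Lemma punion_moved p j : p \in J be ->
  punion (moved [set p]) j = insert_pos al.+1 be.+1 p P j.
Proof.
move=> pJ; have [m pm] := part_of p.
have mbe : m = be by move: pJ; rewrite pm => /eqP.
rewrite {}mbe in pm.
have eq_off q : q != p -> (q \in punion (moved [set p]) j) = (q \in P j).
  move=> qp; apply/bigcupP/bigcupP => -[i ij qi]; exists i => //; move: qi;
    rewrite !ffunE; case: eqP => _; rewrite ?inE ?qp ?andbT //;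
    by case: eqP => _; rewrite // ?inE (negPf qp) ?orbF.
apply/setP => q; have [->|qp] := eqVneq q p; last first.
  by rewrite eq_off // /insert_pos; case: ifP => _; rewrite // !inE (negPf qp).
transitivity (al < j)%N.
  apply/bigcupP/idP => [[i ij]|alj].
    rewrite ffunE; case: eqP => ib; first by rewrite !inE eqxx.
    case: eqP => [<- //|_]; rewrite pm => /eqP //.
  exists al => //; rewrite ffunE eqxx.
  by rewrite al_neq_be !inE eqxx orbT.
rewrite /insert_pos; case: ifP => [/andP[-> _]|]; first by rewrite !inE eqxx.
by rewrite (mem_punion j pm); lia.
Qed.

(** In U_I the variables of the levels al, ..., be - 1 are numbered by ranks in
    sets containing p.  Renumbering so that the variable at p comes last and the
    others keep their ranks in P_j gives the insertion of the u_i at p. *)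
Lemma W_moved p : p \in J be ->
  W h lam (moved [set p])
  = Sym lam (posU N H P y
             * \prod_(al.+1 <= i < be.+1) insfactor H P y i p (u i)).
Proof.
move=> pJ; have [m pm] := part_of p.
have mbe : m = be by move: pJ; rewrite pm => /eqP.
rewrite {}mbe in pm.
have abN := ltn_ord be.
have pP j : (p \in P j) = (be < j)%N by rewrite (mem_punion j pm).
set P' := insert_pos al.+1 be.+1 p P.
have cP' j : L j = #|P' j|.
  rewrite L_card /P' /insert_pos; case: ifP => jr; last by rewrite addn0.
  by rewrite cardsU1 pP addnC; congr (_ + _)%N; lia.
have eP j : punion (moved [set p]) j = P' j by rewrite punion_moved.
rewrite /W U_posU; last by move=> j _; rewrite eP -cP'.
have -> : posU N H (punion (moved [set p]))
      (fun j q => tv j (rank (punion (moved [set p]) j) q))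
    = posU N H P' (fun j q => tv j (rank (P' j) q)).
  by apply: eq_posU => [j _|j q _ _]; rewrite ?eP.
pose r' j q := if (al.+1 <= j < be.+1)%N && (q == p) then L j else rank (P j) q.
have r'P j q : q \in P' j -> ((al < j < be.+1)%N /\ q = p /\ r' j q = #|P j|.+1)
     \/ (q \in P j /\ r' j q = rank (P j) q).
  rewrite /P' /insert_pos /r' L_card; case: (al < j < be.+1)%N; last by right.
  rewrite !inE /=; have [-> _|_ /= qP] := eqVneq q p; last by right.
  by left; rewrite addn1.
rewrite (@Sym_relabel _ _ _ _ _ P' (fun j => rank (P' j)) r'); first last.
- move=> q _; rewrite /r' /P' /insert_pos.
  by have -> : (al < N < be.+1)%N = false by lia.
- move=> j q _ qj; rewrite -cP' L_card.
  have [[jr [qp ->]]|[qP ->]] := r'P j q qj.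
    by rewrite jr addn1 ltnSn.
  by have := rank_le qP; lia.
- by move=> j q _ /rank_le.
- move=> j _ q q' /r'P[[_ [-> ->]]|[qP ->]] /r'P[[_ [-> ->]]|[q'P ->]] //.
  + by have := rank_le q'P; lia.
  + by have := rank_le qP; lia.
  exact: rank_inj.
- by move=> j _; apply: rank_inj.
- by move=> j _; apply: cP'.
- by lia.
rewrite -posU_insert ?punion0 //; first last.
- by move=> j jr; rewrite pP; lia.
- by lia.
congr (Sym _ _); apply: eq_posU => // j q _ _.
by rewrite /r' /insert_val; case: ifP.
Qed.

Lemma Aab_cut : Aab n h lam al.+1 be.+1
  = \prod_(al.+1 <= i < be.+1) cut H 0 P y i (u i).
Proof.
rewrite /Aab (@prod_labels _ _ _ P (psum lam) al.+1 be.+1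
  (fun a b => a - b) (fun a b => a - b - H)
  (fun a b => (a - b - H) / (a - b))) //.
- exact: L_be_gt0.
- by move=> j _; apply: L_card.
Qed.

Lemma Bab_cut : Bab n h lam al.+1 be.+1
  = \prod_(al.+1 <= i < be.+1) cut H n P y i (u i).
Proof.
rewrite /Bab (@prod_labels _ _ _ P (psum lam) al.+1 be.+1
  (fun a b => a - b - H) (fun a b => a - b)
  (fun a b => (b - a - H) / (b - a))) //.
- apply: eq_bigr => i _; rewrite /cut; congr (_ * _ * _);
    by apply: eq_bigr => q _; rewrite ltn_ord.
- exact: L_be_gt0.
- by move=> j _; apply: L_card.
Qed.

(** The three cases are those of the part m containing p; as m counts from 0, p
    belongs to P j when m < j. *)
Lemma Sym_cut_step (p : 'I_n) :
  Sym lam (posU N H P y * (\prod_(al.+1 <= i < be.+1) cut H p P y i (u i)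
                     - \prod_(al.+1 <= i < be.+1) cut H p.+1 P y i (u i)))
  = if p \in J be then - H * W h lam (moved [set p]) else 0.
Proof.
have [m pm] := part_of p; rewrite pm.
have pP j : (p \in P j) = (m < j)%N by rewrite (mem_punion j pm).
have abN := ltn_ord be.
have [mbe|bem|mE] := ltngtP m be; last first.
- have {}mE : m = be by apply: val_inj.
  rewrite mE eqxx W_moved ?pm ?mE // in pP *.
  have pos i : (al < i < be.+1)%N -> [/\ (be < i.-1)%N = false,
      (be < i.+1)%N = (i == be) & (be < i)%N = false].
    by move=> ir; split; lia.
  have cutE k (E : nat -> F) : (forall i, (al < i < be.+1)%N ->
        cut H k P y i (u i) = insfactor H P y i p (u i)
                              * (if i == be then E i else 1)) ->
      \prod_(al.+1 <= i < be.+1) cut H k P y i (u i)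
      = \prod_(al.+1 <= i < be.+1) insfactor H P y i p (u i) * E be.
    move=> cE; rewrite (eq_big_nat _ _ cE) big_split /= -big_mkcond big_nat1_eq.
    by rewrite al_lt_be ltnSn.
  rewrite (cutE p (fun i => u i - y i.+1 p - H)); last first.
    move=> i ir; rewrite cut_before !pP; have [-> -> ->] := pos i ir.
    by rewrite mul1r mulr1.
  rewrite (cutE p.+1 (fun i => u i - y i.+1 p)); last first.
    move=> i ir; rewrite cut_after !pP; have [-> -> ->] := pos i ir.
    by rewrite mul1r mulr1.
  rewrite mulNr -Sym_cst -[RHS](raddfN (Sym lam)); congr (Sym lam _).
  set G := \prod_(_ <= _ < _) _; set V := posU _ _ _ _; ring.
- have -> : (be == m) = false by apply/negbTE; rewrite neq_ltn bem.
  rewrite (eq_big_nat _ _ (F2 := fun i => cut H p.+1 P y i (u i))).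
    by rewrite subrr mulr0 raddf0.
  move=> i ir; rewrite cut_before cut_after !pP.
  by rewrite !ifF //; lia.
have -> : (be == m) = false by apply/negbTE; rewrite neq_ltn mbe orbT.
pose t j := tperm (inord (L j)) (inord (rank (P j) p)) : 'S_n.+1.
have Lle := L_le.
have rle j q : (rank (P j) q <= n)%N := rank_le_max (P j) q.
have jr_ne j : (maxn al.+1 m.+1 <= j < be.+1)%N -> [/\ (0 < j < N)%N, p \in P j,
    (rank (P j) p < L j)%N & L j = #|P j|.+1].
  move=> jr; have pj : p \in P j by rewrite pP; lia.
  have := rank_le pj; rewrite L_card => rj; split=> //; lia.
have two_neq0F : 2%:R != 0 :> F.
  by rewrite -(rmorph_nat (@tofrac _)) tofrac_eq0 -mpolyC_nat mpolyC_eq0.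
apply: (@occupied_vanish _ H N n al.+1 be.+1 m.+1 p P y u
          (fun j => vsubst j (t j)) (Sym lam)).
- by [].
- by [].
- exact: abN.
- by [].
- exact: mbe.
- exact: punion0.
- exact: pP.
- exact: two_neq0F.
- by move=> j; apply: vsubst_cst.
- by move=> i j ij x; apply: vsubstC; rewrite eq_sym.
- by move=> i j iN ij; apply: vsubst_tvar_neq.
- by move=> i j q iN ij; apply: vsubst_tvar_neq.
- move=> j /jr_ne[jN pj rL _]; apply: vsubst_tvar_eq => //; first by lia.
  exact: tpermL.
- move=> j /jr_ne[jN pj rL _]; apply: vsubst_tvar_eq => //; first by lia.
  exact: tpermR.
- move=> j q /jr_ne[jN pj rL LE] qp qj.
  apply: vsubst_tvar_eq => //; first by lia.
  have rq := rank_le qj; have := Lle j; have := rle j p => rp Lj.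
  apply: tpermD; apply/eqP => /(congr1 val); rewrite /= !inordK; try lia.
  by move/(rank_inj pj qj) => e; rewrite e eqxx in qp.
- by move=> j _ x /=; rewrite vsubstM tperm2 vsubst1.
- move=> j /jr_ne[jN pj rL LE] x; apply: Sym_vsubst => //.
  apply: subset_trans (tperm_on _ _) _; apply/subsetP => a.
  have := rank_le pj; have := Lle j; have := rle j p => rp Lj rk.
  by rewrite !inE -/(L j) => /orP[] /eqP ->; rewrite inordK; lia.
- move=> j /jr_ne[jN pj rL LE]; rewrite subr_eq0; apply/eqP.
  by move/(tvar_inj (rle j p) (Lle j)); lia.
Qed.

Lemma dtilde_U : dtilde h lam al be (U h (shift lam al be) J) =
  - H * \sum_(1 <= b < (lam be).+2) W h lam (move J be al b).
Proof.
rewrite (sum_moved (W h lam)) mulr_sumr big_mkcond /=.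
under eq_bigr do rewrite -Sym_cut_step.
rewrite -raddf_sum -mulr_sumr /dtilde Aab_cut Bab_cut.
rewrite U_posU; last by move=> j _; rewrite card_punion.
congr (Sym _ (_ * _)).
pose X k := \prod_(al.+1 <= i < be.+1) cut H k P y i (u i).
rewrite -(big_mkord xpredT (fun k => X k - X k.+1)).
rewrite (telescope_sumr_eq (fun k => - X k)) ?opprK 1?addrC // => k _.
by rewrite opprK addrC.
Qed.
End Insertion.

Theorem theorem4p3 (R : realType) (N n : nat) (N_gt0 : (0 < N)%N)
  (n_gt0 : (0 < n)%N) (h : R[i]) (h_neq0 : h != 0)
  (lam : {ffun 'I_N -> nat}) (lam_sum : (\sum_(i < N) lam i = n)%N)
  (al be : 'I_N) (al_lt_be : (al < be)%N) (lam_al : (1 <= lam al)%N)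
  (J : {ffun 'I_N -> {set 'I_n}}) (J_part : J \in opart n (shift lam al be)) :
  dtilde h lam al be (U h (shift lam al be) J) =
  - cst N n h * \sum_(1 <= b < (lam be).+2) W h lam (move J be al b).
Proof.
by apply: dtilde_U => //; rewrite Num.Theory.pnatr_eq0.
Qed.
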